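(* Let $\alpha\in\mathbb{J}$. Assume $\{S(t)\}_{t\ge0}$ is a semigroup in the scale, $P=\{P_1,\ldots,P_n\}\in\mathscr{P}_{\beta_1,\ldots,\beta_n,R}$, and $$\|S(t)\|_{\mathcal{L}(X^\alpha)}\le M_0e^{\omega_\alpha t},\quad t\ge0.$$ Then for any $a>\omega_\alpha$ there exist a constant $M_1$ and constants $c_i=c_i(\alpha,\beta_i)$, $i=1,\ldots,n$ (which, for the given semigroup and the given $a$, do not depend on the perturbations), such that for $u_0\in X^\alpha$ $$\|S_P(t)u_0\|_\alpha\le M_1\|u_0\|_\alpha e^{(a+\theta_P)t},\quad t>0,\qquad\text{with}\qquad \theta_P=\sum_{i=1}^nc_i\|P_i\|_{\mathcal{L}(X^\alpha,X^{\beta_i})}^{\frac1{1-d(\alpha,\beta_i)}}.$$ Also, for any $\gamma\in\mathcal{E}_\alpha$ and $T>0$ there is a constant $M=M(T)$ such that $$\|S_P(t)\|_{\mathcal{L}(X^\gamma,X^\alpha)}\le\begin{cases}\dfrac{M}{t^{d(\alpha,\gamma)}}, & 0<t\le T,\\ Me^{(a+\theta_P)t}, & T<t.\end{cases}$$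
   Context: Scale of spaces: $\mathbb{J}$ is a set of indices and $\{X^\gamma\}_{\gamma\in\mathbb{J}}$ a family of Banach spaces (norms $\|\cdot\|_\gamma$) that is topologically consistent: if a sequence in $X^\gamma\cap X^{\tilde\gamma}$ converges in both spaces, the limits coincide. A map $\mathtt{r}:\mathbb{J}\to\mathbb{R}$ (regularity index) is given and $d(\tilde\gamma,\gamma):=\mathtt{r}(\tilde\gamma)-\mathtt{r}(\gamma)$. $\{S(t)\}_{t\ge0}$ is a family of linear operators with $S(0)=I$ defined consistently on the spaces of the scale (if $u_0\in X^\gamma\cap X^{\tilde\gamma}$, the values of $S(t)u_0$ in the two spaces coincide). Smoothing: $\gamma\stackrel{S(t)}{\dashrightarrow}\tilde\gamma$ means that $d(\tilde\gamma,\gamma)\ge0$ and for any $T>0$ there is a constant $M=M(\gamma,\tilde\gamma,T)$ (nondecreasing in $T$) with $\|S(t)\|_{\mathcal{L}(X^\gamma,X^{\tilde\gamma})}\le M t^{-d(\tilde\gamma,\gamma)}$ for $0<t\le T$. $\gamma\stackrel{S(t)}{\leadsto}\tilde\gamma$ means that in addition $(0,\infty)\ni t\mapsto S(t)u_0\in X^{\tilde\gamma}$ is continuous for each $u_0\in X^\gamma$. $\{S(t)\}$ is a semigroup in the scale if for each $\gamma\in\mathbb{J}$ it is a (not necessarily $C^0$) semigroup in $X^\gamma$ and $\gamma\stackrel{S(t)}{\leadsto}\gamma$. Perturbations: for fixed $\alpha\in\mathbb{J}$, $R>0$ and $\beta\in\mathbb{J}$, $\mathscr{P}_{\beta,R}$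 is the set of $P\in\mathcal{L}(X^\alpha,X^\beta)$ with $\|P\|_{\mathcal{L}(X^\alpha,X^\beta)}\le R$, where $\alpha,\beta$ satisfy $0\le d(\alpha,\beta)<1$ and $\beta\stackrel{S(t)}{\leadsto}\alpha$. $P=\{P_1,\ldots,P_n\}\in\mathscr{P}_{\beta_1,\ldots,\beta_n,R}$ means $P_i\in\mathscr{P}_{\beta_i,R}$ for each $i$. Perturbed family: $\mathcal{E}_\alpha:=\{\gamma\in\mathbb{J}:\mathtt{r}(\gamma)\in(\mathtt{r}(\alpha)-1,\mathtt{r}(\alpha)]\text{ and }\gamma\stackrel{S(t)}{\leadsto}\alpha\}$. $\mathcal{L}^\infty_{\alpha,\varepsilon}$ is the set of strongly measurable $\varphi:(0,\infty)\to X^\alpha$ with $\sup_{t\in(0,T]}t^\varepsilon\|\varphi(t)\|_\alpha<\infty$ for every $T>0$. For $\gamma\in\mathcal{E}_\alpha$ and $u_0\in X^\gamma$ there is a unique $u\in\mathcal{L}^\infty_{\alpha,d(\alpha,\gamma)}$ with $u(t)=S(t)u_0+\sum_{i=1}^n\int_0^tS(t-\tau)P_iu(\tau)\,d\tau$ for all $t>0$; $S_P(t)u_0:=u(t)$ for $t>0$ and $S_P(0)u_0:=u_0$. *)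

(* Defs.v *)
From HB Require Import structures.
From mathcomp Require Import all_boot all_order all_algebra.
From mathcomp Require Import all_classical all_reals all_analysis.

Set Implicit Arguments.
Unset Strict Implicit.
Unset Printing Implicit Defensive.

Import Order.TTheory GRing.Theory Num.Theory.
Import numFieldNormedType.Exports.

Local Open Scope classical_set_scope.
Local Open Scope ring_scope.

(* ||f||_{L(X,Y)}: the least C >= 0 with |f x| <= C |x| for all x, and +oo when
   f is unbounded; it is meant for linear f. *)
Definition opnorm (R : realType) (X Y : normedModType R) (f : X -> Y) : \bar R :=
  ereal_inf [set C%:E | C in [set C : R | 0 <= C /\ forall x, `|f x| <= C * `|x|]].

Section bochner.
Context {R : realType} {X : normedModType R}.
Local Notation mu := (@lebesgue_measure R).
Implicit Types (D : set R) (f s : R -> X).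

Definition simple_on D s : Prop :=
  [/\ finite_set (range s),
      forall x : X, measurable (s @^-1` [set x]) &
      forall x : X, x != 0 -> (mu (D `&` s @^-1` [set x]) < +oo)%E].

Definition simple_integral D s : X :=
  \sum_(x \in range s) fine (mu (D `&` s @^-1` [set x])) *: x.

Definition strongly_measurable D f : Prop :=
  exists s : nat -> R -> X,
    (forall k, simple_on D (s k)) /\
    {ae mu, forall t, D t -> s ^~ t @ \oo --> f t}.

(* Strong measurability is required separately because \int is only a lower
   integral on functions that are not measurable. *)
Definition is_bochner_integral D f (y : X) : Prop :=
  strongly_measurable D f /\
  exists s : nat -> R -> X,
    [/\ forall k, simple_on D (s k),
        (fun k => \int[mu]_(t in D) (`|f t - s k t|)%:E)%E @ \oo --> 0%E &
        simple_integral D (s k) @[k --> \oo] --> y].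

End bochner.

(* The spaces of the scale are realized inside a vector space [ambient] without
   topology, which gives a meaning to their intersections. *)
Record banach_scale (R : realType) := BanachScale {
  indices : Type;
  space : indices -> completeNormedModType R;
  ambient : lmodType R;
  emb : forall g : indices, {linear space g -> ambient};
  emb_inj : forall g, injective (emb g);
  topologically_consistent :
    forall (g g' : indices) (u : nat -> space g) (u' : nat -> space g')
      (l : space g) (l' : space g'),
      (forall k, emb g (u k) = emb g' (u' k)) ->
      u @ \oo --> l -> u' @ \oo --> l' -> emb g l = emb g' l';
  reg : indices -> R }.

Coercion space : banach_scale >-> Funclass.

Definition dist_reg (R : realType) (X : banach_scale R) (g' g : indices X) : R :=
  reg g' - reg g.

(* The element of [X g] represented by [v]; 0 if [v] is not in [X g]. *)
Definition in_space (R : realType) (X : banach_scale R) (g : indices X)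
    (v : ambient X) : X g :=
  xget 0 [set x : X g | emb g x = v].

Record scale_family (R : realType) (X : banach_scale R) := ScaleFamily {
  family : R -> forall g : indices X, {linear X g -> ambient X};
  family0 : forall (g : indices X) (u : X g), family 0 g u = emb g u;
  family_consistent :
    forall (t : R) (g g' : indices X) (u : X g) (u' : X g'), 0 <= t ->
      emb g u = emb g' u' -> family t g u = family t g' u' }.

Section perturbation.
Context {R : realType} {X : banach_scale R} (S : scale_family X).
Implicit Types (g : indices X) (t : R).

Definition maps_into t g g' : Prop :=
  forall u : X g, exists v : X g', emb g' v = family S t g u.

(* S(t) as a map from [X g] to [X g'], meaningful when [maps_into t g g']. *)
Definition op g g' t (u : X g) : X g' := in_space g' (family S t g u).
Arguments op : clear implicits.

Definition smoothing g g' : Prop :=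
  0 <= dist_reg g' g /\
  exists M : R -> R,
    {homo M : T T' / T <= T'} /\
    forall T t, 0 < t <= T ->
      maps_into t g g' /\
      (opnorm (op g g' t) <= (M T * t `^ (- dist_reg g' g))%:E)%E.

Definition csmoothing g g' : Prop :=
  smoothing g g' /\
  forall u : X g, {within `]0, +oo[, continuous (fun t => op g g' t u)}.

Definition semigroup_in_scale : Prop :=
  forall g,
    [/\ forall t, 0 <= t -> maps_into t g g /\ (opnorm (op g g t) < +oo)%E,
        forall s t (u : X g), 0 <= s -> 0 <= t ->
          op g g (s + t) u = op g g s (op g g t u) &
        csmoothing g g].

Definition perturbation_class (a b : indices X) (r : R) (P : {linear X a -> X b}) :
    Prop :=
  [/\ 0 <= dist_reg a b < 1, csmoothing b a & (opnorm P <= r%:E)%E].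

Definition Eset (a : indices X) : set (indices X) :=
  [set g | reg a - 1 < reg g <= reg a /\ csmoothing g a].

(* Functions on (0,oo) are represented by functions on R whose values at t <= 0
   are ignored. *)
Definition Linfty (a : indices X) (e : R) : set (R -> X a) :=
  [set f | strongly_measurable `]0, +oo[ f /\
    forall T, 0 < T -> exists C, forall t, 0 < t <= T -> t `^ e * `|f t| <= C].

Section perturbed.
Context (n : nat) (a : indices X) (b : 'I_n -> indices X)
        (P : forall i, {linear X a -> X (b i)}).

Definition is_mild_solution g (u0 : X g) (u : R -> X a) : Prop :=
  Linfty (dist_reg a g) u /\
  forall t, 0 < t ->
    exists I : 'I_n -> X a,
      (forall i, is_bochner_integral `]0, t[
         (fun tau => op (b i) a (t - tau) (P i (u tau))) (I i)) /\
      u t = op g a t u0 + \sum_(i < n) I i.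

(* S_P(t) as a map from [X g] to [X a], for g in [Eset a]; the mild solution is
   unique on (0,oo), so the choice made by [xget] does not matter for t > 0. *)
Definition perturbed g t (u0 : X g) : X a :=
  if t == 0 then in_space a (emb g u0)
  else xget (fun=> 0) [set u | is_mild_solution u0 u] t.

Definition theta (c : indices X -> R) : R :=
  \sum_(i < n) c (b i) * fine (opnorm (P i)) `^ (1 - dist_reg a (b i))^-1.

End perturbed.
End perturbation.

Arguments op {R X} S g g' t u.
Arguments perturbed {R X} S {n a b} P g t u0.

(* Main.v *)
Require Import Defs.
From mathcomp Require Import all_boot all_order all_algebra.
From mathcomp Require Import all_classical all_reals all_analysis.
From mathcomp Require Import measurable_realfun ring lra.
Import Order.TTheory GRing.Theory Num.Theory.
Import numFieldNormedType.Exports.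
Local Open Scope classical_set_scope.
Local Open Scope ring_scope.

(** Only an a priori bound is at stake: [perturbed] is either 0 or the value of a
    mild solution, so it suffices to bound the norm of every mild solution [u].

    The semigroup property turns the short-time smoothing of [S] and its
    exponential bound on the space of [alpha] into
    [|S(t) v| <= K t^-d e^(a t) |v|] for all [t > 0], since [omega < a]
    ([smoothing_expR_bound]), where [d] is the distance to [alpha]: [d_i] for the
    space of [beta i], and [e] for the space of the initial datum.  Hence, with
    [p_i] the norm of [P_i], the norm of [u] satisfies a Volterra inequality with
    the kernels [K_i p_i (t - s)^-d_i e^(a (t - s))].

    After multiplication by [e^(-(a + m) t)] the kernels carry the extra factor
    [e^(-m (t - s))], and
    [int_0^t (t - s)^-d e^(-m (t - s)) s^-e ds <= C m^(d - 1) t^-e]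
    ([integral_convolution_kernel_le]).  If [p_i <= kap_i m^(1 - d_i)], then the
    [i]-th term of the equation contributes at most [kap_i K_i C] times the
    weighted supremum of [|u|] ([bochner_duhamel_le]).  Taking the [kap_i] small,
    depending on [K_i] and [C] but not on [P], makes the sum of these factors at
    most one half; the weighted supremum, finite because [u] lies in
    [Linfty], is then absorbed and at most twice the contribution of the initial
    datum ([half_contraction_le]).

    The value [m = sum_i (p_i / kap_i)^(1 / (1 - d_i))] is admissible
    ([le_growth_rate]), which is exactly the form of [theta]; this gives the
    first bound, where the initial datum is in the space of [alpha] and the
    weight is [e^(-(a + theta) t)].  For data in a larger space the weight needs a
    factor [t^e], which changes [C] and would change the growth rate, so the
    argument is run twice.  On [(0, T]] a larger [m], depending on [r] and [gamma],
    is harmless ([mild_weighted_le]).  Beyond [T] the rate [theta] is used again, the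
    early part of [u] being a source term controlled by the first run
    ([mild_late_le]). *)

(** * Bochner integrals *)

Section bochner_bound.
Context {R : realType} {X : normedModType R}.
Local Notation mu := (@lebesgue_measure R).

(** The integral of a nonnegative function is a supremum over the simple functions
    below it, hence monotone without measurability; the functions [|f - s_k|] in
    the definition of the Bochner integral are not assumed measurable. *)
Lemma le_lower_integral (D : set R) (f g : R -> \bar R) :
  (forall t, D t -> (0 <= f t)%E) -> (forall t, D t -> (f t <= g t)%E) ->
  (\int[mu]_(t in D) f t <= \int[mu]_(t in D) g t)%E.
Proof.
move=> f0 fg; rewrite !ge0_integralE//; last first.
  by move=> t Dt; apply: le_trans (f0 t Dt) (fg t Dt).
apply: le_ereal_sup => _ [h hf <-]; exists h => // t.
apply: le_trans (hf t) _; rewrite /patch; case: ifPn => //.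
by rewrite inE; exact: fg.
Qed.

Lemma norm_simpleE {D} {s : R -> X} t : simple_on D s ->
  `|s t| = \sum_(x <- finmap.enum_fset (fset_set (range s)))
             `|x| * \1_(s @^-1` [set x]) t.
Proof.
move=> [fs _ _].
rewrite (bigD1_seq (s t)) ?finmap.fset_uniq//=; last first.
  by rewrite in_fset_set// inE; exists t.
rewrite indicE mem_set// mulr1 big1 ?addr0// => x xst.
by rewrite indicE memNset ?mulr0//= => xs; rewrite -xs eqxx in xst.
Qed.

Lemma measurable_norm_simple {D} {s : R -> X} :
  simple_on D s -> measurable_fun [set: R] (fun t => `|s t|).
Proof.
move=> sD; rewrite (_ : (fun t => _) =
    (fun t => \sum_(x <- finmap.enum_fset (fset_set (range s)))
       `|x| * \1_(s @^-1` [set x]) t)); last first.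
  by apply/funext => t; exact: norm_simpleE sD.
apply: measurable_sum => x; apply: measurable_funM => //.
by apply: measurable_indic; case: sD.
Qed.

Lemma norm_simple_integral_le {D} {s : R -> X} : measurable D ->
  simple_on D s ->
  (`|simple_integral D s|%:E <= \int[mu]_(t in D) `|s t|%:E)%E.
Proof.
move=> mD sD; have [fs ms ls] := sD.
under eq_integral do rewrite (norm_simpleE _ sD) -sumEFin.
rewrite ge0_integral_sum//; last first.
  move=> x; apply/measurable_EFinP/measurable_funM => //.
  by apply: measurable_indic; exact: ms.
rewrite /simple_integral fsbig_finite//=.
apply: (@le_trans _ _ (\sum_(x <- finmap.enum_fset (fset_set (range s)))
  (`|fine (mu (D `&` s @^-1` [set x])) *: x|)%:E)%E).
  by rewrite sumEFin lee_fin ler_norm_sum.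
apply: lee_sum => x _.
under eq_integral do rewrite EFinM.
rewrite ge0_integralZl_EFin//; last first.
  by apply/measurable_EFinP/measurable_indic; exact: ms.
rewrite integral_indic//; last exact: ms.
rewrite setIC normrZ EFinM muleC.
have [->|x0] := eqVneq x 0; first by rewrite normr0 !mul0e.
rewrite lee_pmul// ?lee_fin// ger0_norm ?fine_ge0// fineK// ge0_fin_numE//.
by rewrite setIC; exact: ls.
Qed.

(** The approximating simple functions satisfy [(|s_k| - g)^+ <= |f - s_k|], so
    [int |s_k| <= int |f - s_k| + int g], and [k] tends to infinity.  Going through
    the positive part keeps every function that has to be split measurable. *)
Lemma bochner_norm_le {D : set R} {f : R -> X} (g : R -> R) {y} : measurable D ->
  measurable_fun D g -> (forall t, D t -> `|f t| <= g t) ->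
  is_bochner_integral D f y -> (`|y|%:E <= \int[mu]_(t in D) (g t)%:E)%E.
Proof.
move=> mD mg fg [_ [s [sD sf sy]]].
have g0 t : D t -> 0 <= g t by move=> /fg; exact: le_trans.
have ms k : measurable_fun D (fun t => `|s k t|).
  by apply: measurable_funTS; exact: measurable_norm_simple (sD k).
pose h k t := Num.max (`|s k t| - g t) 0.
have mh k : measurable_fun D (h k).
  by apply: measurable_maxr => //; exact: measurable_funB.
have h0 k t : 0 <= h k t by rewrite le_max lexx orbT.
have hle k : (`|simple_integral D (s k)|%:E <=
    \int[mu]_(t in D) `|f t - s k t|%:E + \int[mu]_(t in D) (g t)%:E)%E.
  apply: le_trans (norm_simple_integral_le mD (sD k)) _.
  apply: (@le_trans _ _ (\int[mu]_(t in D) ((h k t)%:E + (g t)%:E))%E).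
    apply: le_lower_integral => t Dt; first by rewrite lee_fin.
    by rewrite -EFinD lee_fin -lerBlDr le_max lexx.
  rewrite ge0_integralD//; last 3 first.
  - by move=> t _; rewrite lee_fin.
  - by apply/measurable_EFinP; exact: mh.
  - by apply/measurable_EFinP.
  rewrite leeD2r//; apply: le_lower_integral => t Dt; first by rewrite lee_fin.
  rewrite lee_fin ge_max normr_ge0 andbT lerBlDr.
  rewrite -[leLHS](_ : `|f t - (f t - s k t)| = _); last first.
    by rewrite opprB addrC subrK.
  by rewrite (le_trans (ler_normB _ _))// addrC lerD2l fg.
have [gy|] := eqVneq (\int[mu]_(t in D) (g t)%:E)%E +oo%E.
  by rewrite gy leey.
move=> gfin; have gf : (\int[mu]_(t in D) (g t)%:E)%E \is a fin_num.
  by rewrite ge0_fin_numE ?ltey// integral_ge0.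
have ly : `|simple_integral D (s k)|%:E @[k --> \oo] --> `|y|%:E.
  by apply: cvg_EFin; [exact: nearW|apply: cvg_norm].
have lr : (\int[mu]_(t in D) `|f t - s k t|%:E + \int[mu]_(t in D) (g t)%:E)%E
   @[k --> \oo] --> (\int[mu]_(t in D) (g t)%:E)%E.
  rewrite -[X in _ --> X]add0e; apply: cvgeD => //.
  exact: cvg_cst.
rewrite -(cvg_lim _ ly)// -(cvg_lim _ lr)//.
apply: lee_lim.
- by apply/cvg_ex; exists `|y|%:E.
- by apply/cvg_ex; eexists; exact: lr.
exact: nearW.
Qed.

End bochner_bound.

(** * The singular kernel *)

Section kernel.
Context {R : realType}.
Local Notation mu := (@lebesgue_measure R).

(** Both [f] and the derivative of [F] may blow up at the end points, so the
    fundamental theorem of calculus is applied on an exhausting sequence of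
    compact intervals. *)
Lemma integral_oo_derivative_le (F f : R -> R) (a b C : R) : a < b ->
  (forall x, a < x < b -> is_derive x 1 F (f x)) ->
  (forall x, a < x < b -> {for x, continuous f}) ->
  (forall x, a < x < b -> 0 <= f x) ->
  (forall x y, a < x -> x < y -> y < b -> F y - F x <= C) ->
  (\int[mu]_(x in `]a, b[) (f x)%:E <= C%:E)%E.
Proof.
move=> ab dF cf f0 FC.
(* The denominator starts at 3 so that the first interval is nondegenerate. *)
pose e (k : nat) : R := (b - a) / k.+3%:R.
have e0 k : 0 < e k by rewrite divr_gt0 ?subr_gt0// ltr0n.
have e2 k : a + e k < b - e k.
  rewrite ltrBrDr -addrA -ltrBrDl -mulr2n -mulr_natr /e mulrAC -mulrA.
  rewrite gtr_pMr ?subr_gt0//.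
  by rewrite ltr_pdivrMr ?ltr0n// mul1r ltr_nat.
pose G k : set R := `[a + e k, b - e k]%classic.
have eG : `]a, b[%classic = \bigcup_k G k.
  apply/seteqP; split => x /=.
    rewrite in_itv/= => /andP[ax xb].
    pose m := Num.min (x - a) (b - x).
    have m0 : 0 < m by rewrite lt_min !subr_gt0 ax.
    pose k := Num.trunc ((b - a) / m).
    exists k => //; rewrite /G/= in_itv/=.
    have : e k <= m.
      rewrite ler_pdivrMr ?ltr0n// mulrC -ler_pdivrMr//.
      have /andP[_ /ltW/le_trans] : k%:R <= (b - a) / m < k.+1%:R.
        by apply: truncn_itv; rewrite divr_ge0 ?subr_ge0//; exact: ltW.
      by move=> h; apply: h; rewrite ler_nat; exact: leqW (leqnSn _).
    rewrite le_min => /andP[h1 h2]; apply/andP; split; lra.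
  move=> [k _]; rewrite /G/= !in_itv/= => /andP[h1 h2].
  by have := e0 k; move=> ?; apply/andP; split; lra.
have Gab k x : G k x -> a < x < b.
  by move=> Gx; have : `]a, b[%classic x by rewrite eG; exists k.
rewrite eG.
have cG k : {within G k, continuous f}.
  by apply: continuous_in_subspaceT => x /[!inE] /Gab; exact: cf.
have cvgG : (\int[mu]_(x in G k) (f x)%:E)%E @[k --> \oo] -->
    (\int[mu]_(x in \bigcup_k G k) (f x)%:E)%E.
  apply: ge0_nondecreasing_set_cvg_integral.
  - apply/nondecreasing_seqP => l; apply/subsetPset => x.
    rewrite /G/= !in_itv/= => /andP[h1 h2].
    have : e l.+1 <= e l.
      by rewrite ler_pM2l ?subr_gt0// lef_pV2 ?posrE ?ltr0n// ler_nat.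
    by move=> ?; apply/andP; split; lra.
  - by move=> l; exact: measurable_itv.
  - move=> l; apply/measurable_EFinP.
    apply: subspace_continuous_measurable_fun => //.
    by rewrite /G; exact: measurable_itv.
  - by move=> l x /Gab; rewrite /= lee_fin; exact: f0.
apply: (cvge_le _ cvgG).
apply: nearW => k.
have Gk x : x \in `[a + e k, b - e k] -> a < x < b by move=> xG; apply: (Gab k).
rewrite (@continuous_FTC2 _ f F)//; last 3 first.
- exact: cG.
- have dFG : {in `[a + e k, b - e k], forall x, derivable F x 1}.
    by move=> x /Gk/dF[].
  have := derivable_within_continuous dFG.
  move=> /(continuous_within_itvP _ (e2 k))[_ Fl Fr]; split => // x xG.
  by apply: dFG; exact: subset_itv_oo_cc.
- by move=> x xG; rewrite derive1E; have [] := dF x; first exact/Gk/subset_itv_oo_cc.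
by rewrite -EFinB lee_fin FC// ?ltrDl ?gtrBl.
Qed.

Lemma continuous_powR (p x : R) : 0 < x -> {for x, continuous (@powR R ^~ p)}.
Proof.
move=> x0; apply/differentiable_continuous/derivable1_diffP.
by apply: ex_derive; exact: is_derive1_powR.
Qed.

Lemma powRN_le_double (e t s : R) : 0 <= e <= 1 -> 0 < t -> t / 2 <= s ->
  s `^ (- e) <= 2 * t `^ (- e).
Proof.
move=> /andP[e0 e1] t0 ts; have s0 : 0 < s by apply: lt_le_trans ts; lra.
rewrite !powRN -[leRHS]invrK lef_pV2 ?posrE ?powR_gt0//; last first.
  by rewrite invr_gt0 mulr_gt0 ?invr_gt0 ?powR_gt0.
rewrite invfM invrK.
apply: (@le_trans _ _ ((t / 2) `^ e)); last first.
  by rewrite ge0_ler_powR ?nnegrE//; apply/ltW => //; lra.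
rewrite powRM ?invr_ge0 ?(ltW t0)// mulrC ler_pM2l ?powR_gt0//.
rewrite -[leLHS]powRr1 ?invr_ge0//; apply: ger_powR => //.
by apply/andP; split; lra.
Qed.

Lemma expRN_le_sqr (x : R) : 0 <= x -> expR (- x) <= 4 * (1 + x) ^- 2.
Proof.
move=> x0; rewrite expRN -[leRHS]invrK lef_pV2 ?posrE ?expR_gt0//; last first.
  by rewrite invr_gt0 mulr_gt0 ?invr_gt0 ?exprn_gt0//; lra.
rewrite invfM invrK.
have -> : x = x / 2 + x / 2 by lra.
rewrite expRD; have := expR_ge1Dx (x / 2); set E := expR _ => hE.
rewrite -expr2; apply: (@le_trans _ _ ((1 + x / 2) ^+ 2)); last first.
  by rewrite lerXn2r ?nnegrE//; lra.
nra.
Qed.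

(** With [w = 1 + m s >= 1] the right-hand side is [4 (s / w)^-d w^-2]; it
    dominates because [w^d >= 1] and [e^(-m s) <= 4 w^-2].  Unlike the left-hand
    side it has an elementary primitive. *)
Lemma kernel_le_derivative (d m s : R) : 0 <= d -> 0 < m -> 0 < s ->
  s `^ (- d) * expR (- (m * s)) <=
  4 * ((s^-1 + m)^-1 `^ (- d) * (1 + m * s) ^- 2).
Proof.
move=> d0 m0 s0; have ms : 0 < m * s by rewrite mulr_gt0.
rewrite mulrCA; apply: ler_pM; rewrite ?powR_ge0 ?expR_ge0//; last first.
  by apply: expRN_le_sqr; exact: ltW.
rewrite !powRN lef_pV2 ?posrE ?powR_gt0//; last first.
  by rewrite invr_gt0 addr_gt0 ?invr_gt0.
rewrite ge0_ler_powR ?nnegrE ?invr_ge0 ?addr_ge0 ?invr_ge0 ?(ltW s0) ?(ltW m0)//.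
by rewrite -[leRHS]invrK lef_pV2 ?posrE ?invr_gt0 ?addr_gt0 ?invr_gt0// lerDl ltW.
Qed.

Definition kernel_cst (d e : R) : R := 8 / (1 - d) + 4 / (1 - e).

Lemma kernel_cst_gt0 {d e : R} : d < 1 -> e < 1 -> 0 < kernel_cst d e.
Proof. by move=> d1 e1; rewrite addr_gt0// divr_gt0// subr_gt0. Qed.

(** This is [(s / (1 + m s))^(1 - d)]: it behaves like [s^(1 - d)], the primitive
    of the singularity, near 0 and is bounded by its limit [m^(d - 1)] at
    infinity, which is the scaling in [m] that the estimate needs. *)
Definition kernel_primitive (d m s : R) : R := (s^-1 + m)^-1 `^ (1 - d).

Lemma is_derive_kernel_primitive (d m s : R) : 0 < m -> 0 < s ->
  is_derive s 1 (kernel_primitive d m)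
    ((1 - d) * ((s^-1 + m)^-1 `^ (- d) * (1 + m * s) ^- 2)).
Proof.
move=> m0 s0; have w0 : 0 < s^-1 + m by rewrite addr_gt0 ?invr_gt0.
rewrite /kernel_primitive.
have dV : is_derive s 1 (fun y : R => y^-1) (- s ^- 2 *: (1 : R)).
  by apply: (@is_deriveV _ id); rewrite ?gt_eqF.
have dD : is_derive s 1 (fun y : R => y^-1 + m) (- s ^- 2 *: (1 : R)).
  by rewrite -[X in is_derive _ _ _ X]addr0; apply: is_deriveD.
have dW := @is_deriveV _ (fun y : R => y^-1 + m) s _ 1 (lt0r_neq0 w0) dD.
have dp := @is_derive1_powR _ (1 - d) _ (eq_trans (invr_gt0 _) w0).
have := @is_derive1_comp _ (@powR R ^~ (1 - d))
  (fun y : R => (y^-1 + m)^-1) s _ _ dp dW.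
move/is_derive_eq; apply.
rewrite (_ : 1 - d - 1 = - d); last by lra.
rewrite -[LHS]mulrA; congr (_ * (_ * _)).
rewrite /GRing.scale/= mulr1 mulrNN -!exprVn -exprMn -invfM; congr (_^-1 ^+ 2).
by rewrite mulrDl mulVf ?gt_eqF.
Qed.

Lemma kernel_primitive_bounds (d m s : R) : d < 1 -> 0 < m -> 0 < s ->
  0 <= kernel_primitive d m s <= m `^ (d - 1).
Proof.
move=> d1 m0 s0; rewrite powR_ge0/= -[d - 1]opprB powRN /kernel_primitive.
rewrite -[leRHS]powR_inv1 ?powR_ge0// powRAC powR_inv1; last exact: ltW.
rewrite ge0_ler_powR ?subr_ge0 ?(ltW d1) ?nnegrE ?invr_ge0 ?addr_ge0
  ?invr_ge0 ?(ltW s0) ?(ltW m0)//.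

by rewrite lef_pV2 ?posrE ?addr_gt0 ?invr_gt0// lerDr invr_ge0 ltW.
Qed.

Definition convolution_kernel (d e m t s : R) : R :=
  (t - s) `^ (- d) * expR (- (m * (t - s))) * s `^ (- e).

Lemma convolution_kernel_ge0 d e m t s : 0 <= convolution_kernel d e m t s.
Proof. by rewrite !mulr_ge0 ?powR_ge0 ?expR_ge0. Qed.

Lemma measurable_convolution_kernel (D : set R) d e m t :
  measurable_fun D (convolution_kernel d e m t).
Proof.
apply: measurable_funTS.
have mB : measurable_fun [set: R] (fun s => t - s) by exact: measurable_funB.
apply: measurable_funM; last exact: measurable_powR.
apply: measurable_funM.
  exact: (measurableT_comp (measurable_powR _) mB).
have mN : measurable_fun [set: R] (fun s => - (m * (t - s))).
  by apply: measurable_funN; exact: measurable_funM.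
exact: (measurableT_comp (@measurable_expR R) mN).
Qed.

(** The two singularities are separated at [t / 2]: for [s >= t / 2] the factor
    [s^-e] is at most [2 t^-e], and for [s <= t / 2] the factors in [t - s] are
    at most [2 t^-d e^(-m t / 2)].  Adding both bounds avoids splitting the
    integral. *)
Lemma convolution_kernel_split (d e m t s : R) :
  0 <= d < 1 -> 0 <= e < 1 -> 0 < m -> 0 < s < t ->
  convolution_kernel d e m t s <=
  8 * t `^ (- e) *
    (((t - s)^-1 + m)^-1 `^ (- d) * (1 + m * (t - s)) ^- 2) +
  2 * t `^ (- d) * expR (- (m * (t / 2))) * s `^ (- e).
Proof.
move=> /andP[d0 d1] /andP[e0 e1] m0 /andP[s0 st].
have t0 : 0 < t by exact: lt_trans st.
have ts0 : 0 < t - s by rewrite subr_gt0.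
have D0 : 0 <= ((t - s)^-1 + m)^-1 `^ (- d) * (1 + m * (t - s)) ^- 2.
  by rewrite mulr_ge0 ?powR_ge0// invr_ge0 exprn_ge0// addr_ge0// mulr_ge0// ltW.
rewrite /convolution_kernel; have [ts|st2] := leP (t / 2) s.
- apply: ler_wpDr; first by rewrite !mulr_ge0 ?powR_ge0 ?expR_ge0.
  rewrite (_ : 8 = 4 * 2 :> R); last by lra.
  rewrite -[4 * 2 * _]mulrA -[leRHS]mulrA [leRHS]mulrCA mulrC.
  apply: ler_pM; rewrite ?powR_ge0 ?mulr_ge0 ?powR_ge0 ?expR_ge0//.
    by apply: powRN_le_double => //; rewrite e0 ltW.
  exact: kernel_le_derivative.
- apply: ler_wpDl; first by apply: mulr_ge0 => //; rewrite mulr_ge0 ?powR_ge0.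
  rewrite ler_wpM2r ?powR_ge0// ler_pM ?powR_ge0 ?expR_ge0//.
    by apply: powRN_le_double => //; [rewrite d0 ltW|lra].
  by rewrite ler_expR lerN2 ler_pM2l//; lra.
Qed.

(** The majorant of [convolution_kernel_split] is the derivative of an explicit
    [F].  The first part of [F] increases by a multiple of [t^-e m^(d - 1)] by
    [kernel_primitive_bounds]; the second one by a multiple of
    [t^-e t^(1 - d) e^(-m t / 2)], where
    [(m t)^(1 - d) <= 1 + m t <= 2 e^(m t / 2)]. *)
Lemma integral_convolution_kernel_le (d e m t : R) :
  0 <= d < 1 -> 0 <= e < 1 -> 0 < m -> 0 < t ->
  (\int[mu]_(s in `]0%R, t[) (convolution_kernel d e m t s)%:E <=
   (kernel_cst d e * m `^ (d - 1) * t `^ (- e))%:E)%E.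
Proof.
move=> d01 e01 m0 t0; have [/andP[d0 d1] /andP[e0 e1]] := (d01, e01).
set A := 8 * t `^ (- e); set B := 2 * t `^ (- d) * expR (- (m * (t / 2))).
have A0 : 0 <= A by rewrite mulr_ge0 ?powR_ge0.
have B0 : 0 <= B by rewrite !mulr_ge0 ?powR_ge0 ?expR_ge0.
pose D s : R := (s^-1 + m)^-1 `^ (- d) * (1 + m * s) ^- 2.
pose f s := A * D (t - s) + B * s `^ (- e).
pose F s := - (A / (1 - d)) * kernel_primitive d m (t - s) +
  B / (1 - e) * s `^ (1 - e).
apply: (@le_trans _ _ (\int[mu]_(s in `]0%R, t[) (f s)%:E)%E).
  apply: le_lower_integral => s /=; rewrite in_itv/= => s0t.
    by rewrite lee_fin convolution_kernel_ge0.
  by rewrite lee_fin; exact: convolution_kernel_split.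
apply: (integral_oo_derivative_le F f 0 t _ t0).
- move=> s /andP[s0 st]; have ts0 : 0 < t - s by rewrite subr_gt0.
  have dt : is_derive s 1 (fun y : R => t - y) (0 - 1) by apply: is_deriveB.
  have dH := @is_derive1_comp _ (kernel_primitive d m) (fun y : R => t - y) s _ _
    (is_derive_kernel_primitive d m _ m0 ts0) dt.
  have dp := @is_derive1_powR _ (1 - e) _ s0.
  have := is_deriveD (is_deriveZ (- (A / (1 - d))) dH)
    (is_deriveZ (B / (1 - e)) dp).
  move/is_derive_eq; apply; rewrite /GRing.scale/= /f /D.
  rewrite (_ : 1 - e - 1 = - e); last by lra.
  set u := _ `^ _ * _; set v := _ `^ _.
  by field; apply/andP; split; lra.
- move=> s /andP[s0 st]; have ts0 : 0 < t - s by rewrite subr_gt0.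
  have cts : (t - y) @[y --> s] --> t - s.
    by apply: cvgB; [exact: cvg_cst|exact: cvg_id].
  rewrite /continuous_at /f /D.
  apply: cvgD; apply: cvgM; try exact: cvg_cst.
    apply: cvgM.
      apply: (continuous_cvg _ (h := @powR R ^~ (- d))
        (f := fun y => ((t - y)^-1 + m)^-1)).
        by apply: continuous_powR; rewrite invr_gt0 addr_gt0 ?invr_gt0.
      apply: cvgV; first by rewrite gt_eqF// addr_gt0 ?invr_gt0.
      by apply: cvgD; [apply: cvgV => //; rewrite gt_eqF|exact: cvg_cst].
    have w0 : 0 < 1 + m * (t - s) by rewrite addr_gt0// mulr_gt0.
    apply: cvgV; first by rewrite gt_eqF// exprn_gt0.
    rewrite expr2; under eq_fun do rewrite expr2.
    have cw : (1 + m * (t - y)) @[y --> s] --> 1 + m * (t - s).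
      by apply: cvgD; [exact: cvg_cst|apply: cvgM => //; exact: cvg_cst].
    exact: cvgM.
  exact: continuous_powR.
- move=> s /andP[s0 st]; rewrite /f /D addr_ge0 ?mulr_ge0 ?powR_ge0//.
  by rewrite invr_ge0 exprn_ge0// addr_ge0// mulr_ge0 ?(ltW m0)// subr_ge0 ltW.
move=> x y x0 xy yt.
have tx0 : 0 < t - x by lra.
have ty0 : 0 < t - y by lra.
have /andP[Hx0 Hx] := kernel_primitive_bounds d m _ d1 m0 tx0.
have /andP[Hy0 _] := kernel_primitive_bounds d m _ d1 m0 ty0.
have Ad : 0 <= A / (1 - d) by rewrite divr_ge0// subr_ge0 ltW.
have Be : 0 <= B / (1 - e) by rewrite divr_ge0// subr_ge0 ltW.
have yt1 : y `^ (1 - e) <= t `^ (1 - e).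
  by rewrite ge0_ler_powR ?nnegrE ?subr_ge0//; lra.
have hA : A / (1 - d) * (kernel_primitive d m (t - x)) <= A / (1 - d) * m `^ (d - 1).
  exact: ler_wpM2l.
have hA0 : 0 <= A / (1 - d) * (kernel_primitive d m (t - y)) by exact: mulr_ge0.
have hx : 0 <= B / (1 - e) * x `^ (1 - e) by rewrite mulr_ge0 ?powR_ge0.
have hy : B / (1 - e) * y `^ (1 - e) <= B / (1 - e) * t `^ (1 - e).
  exact: ler_wpM2l.
apply: (@le_trans _ _ (A / (1 - d) * m `^ (d - 1) + B / (1 - e) * t `^ (1 - e))).
  by rewrite /F; lra.
have -> : kernel_cst d e * m `^ (d - 1) * t `^ (- e) =
  A / (1 - d) * m `^ (d - 1) + 4 / (1 - e) * (m `^ (d - 1) * t `^ (- e)).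
  by rewrite /kernel_cst /A; ring.
rewrite lerD2l.
have tm : t `^ (- d) * expR (- (m * (t / 2))) * t <= 2 * m `^ (d - 1).
  have mt0 : 0 < m * t by rewrite mulr_gt0.
  have -> : t `^ (- d) * expR (- (m * (t / 2))) * t =
      t `^ (1 - d) / expR (m * (t / 2)).
    rewrite expRN mulrAC; congr (_ / _).
    rewrite -{2}(powRr1 (ltW t0)) -powRD; last by rewrite (gt_eqF t0) implybT.
    by rewrite addrC.
  rewrite ler_pdivrMr ?expR_gt0//.
  rewrite -(@ler_pM2l _ (m `^ (1 - d))) ?powR_gt0// -powRM ?(ltW m0) ?(ltW t0)//.
  have m1 : m `^ (1 - d) * m `^ (d - 1) = 1.
    rewrite -powRD; last by rewrite (gt_eqF m0) implybT.
    by rewrite (_ : 1 - d + (d - 1) = 0) ?powRr0//; lra.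
  have -> : m `^ (1 - d) * (2 * m `^ (d - 1) * expR (m * (t / 2))) =
    2 * expR (m * (t / 2)) * (m `^ (1 - d) * m `^ (d - 1)) by ring.
  rewrite m1 mulr1.
  have : (m * t) `^ (1 - d) <= 1 + m * t.
    apply: (@le_trans _ _ ((1 + m * t) `^ (1 - d))).
      by rewrite ge0_ler_powR ?nnegrE ?subr_ge0 ?(ltW d1) ?(ltW mt0)//; lra.
    by rewrite ler1_powR//; lra.
  by have := expR_ge1Dx (m * (t / 2)); lra.
rewrite /B.
have -> : t `^ (1 - e) = t * t `^ (- e).
  rewrite -{2}(powRr1 (ltW t0)) -powRD//.
  by rewrite (gt_eqF t0) implybT.
have -> : 2 * t `^ (- d) * expR (- (m * (t / 2))) / (1 - e) * (t * t `^ (- e)) =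
  2 / (1 - e) * t `^ (- e) * (t `^ (- d) * expR (- (m * (t / 2))) * t) by ring.
have -> : 4 / (1 - e) * (m `^ (d - 1) * t `^ (- e)) =
  2 / (1 - e) * t `^ (- e) * (2 * m `^ (d - 1)) by ring.
by rewrite ler_wpM2l// mulr_ge0 ?powR_ge0// divr_ge0// subr_ge0 ltW.
Qed.
End kernel.

(** * Operators of the scale *)

Section operator_norm.
Context {R : realType} {Y Z : normedModType R}.
Implicit Types (f : Y -> Z) (C : R).

Lemma opnorm_ge0 f : (0 <= opnorm f)%E.
Proof. by apply: le_ereal_inf_tmp => _ [C [C0 _] <-]; rewrite lee_fin. Qed.

Lemma opnorm_le f C : 0 <= C -> (forall x, `|f x| <= C * `|x|) ->
  (opnorm f <= C%:E)%E.
Proof. by move=> C0 fC; apply: ge_ereal_inf; exists C%:E => //; exists C. Qed.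

(** The infimum defining [opnorm] is attained. *)
Lemma opnorm_leP {f C} x : (opnorm f <= C%:E)%E -> `|f x| <= C * `|x|.
Proof.
move=> fC; rewrite leNgt; apply/negP => Cf.
have [x0|x0] := eqVneq `|x| 0.
  have : (opnorm f < +oo)%E by apply: le_lt_trans fC _; exact: ltry.
  move=> /ereal_inf_lt[_ [C' [_ fC'] <-] _].
  have := fC' x; rewrite x0 mulr0 leNgt => /negP; apply.
  by move: Cf; rewrite x0 mulr0.
have xp : 0 < `|x| by rewrite lt_neqAle eq_sym x0 normr_ge0.
have : (opnorm f < (`|f x| / `|x|)%:E)%E.
  by apply: le_lt_trans fC _; rewrite lte_fin ltr_pdivlMr.
move=> /ereal_inf_lt[_ [C' [_ fC'] <-]]; rewrite lte_fin ltr_pdivlMr//.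
by rewrite ltNge fC'.
Qed.

End operator_norm.

Section scale.
Context {R : realType} {X : banach_scale R} (S : scale_family X).
Hypothesis hS : semigroup_in_scale S.
Implicit Types g : indices X.

Lemma emb_op {g g' t} {u : X g} :
  maps_into S t g g' -> emb g' (op S g g' t u) = Defs.family S t g u.
Proof.
move=> /(_ u)[v vu]; rewrite /op /in_space.
by case: xgetP => [_ -> //|/(_ v)].
Qed.

(** The semigroup law is only assumed inside each space; it holds between two
    spaces because the values of [S s] on the two representatives of the same
    ambient vector coincide. *)
Lemma op_comp g g' s t (u : X g) : 0 <= s -> 0 <= t -> maps_into S t g g' ->
  op S g g' (s + t) u = op S g' g' s (op S g g' t u).
Proof.
move=> s0 t0 tg; have [tgg Sst _] := hS g.
rewrite {1 2}/op; congr (in_space _ _).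
rewrite -(emb_op (proj1 (tgg _ (addr_ge0 s0 t0)))) Sst//.
rewrite (emb_op (proj1 (tgg _ s0))); apply: family_consistent => //.
by rewrite !emb_op//; exact: (proj1 (tgg _ t0)).
Qed.

(** For [t <= 1] this is the smoothing estimate with [T = 1].  For [t > 1], write
    [S t] as [S (t - 1)] after [S 1]; the gap between [omega] and [a] pays for the
    factor [t^-d], because [t^d <= t <= e^((a - omega) t) / (a - omega)]. *)
Lemma smoothing_expR_bound (al g : indices X) (M0 omega a : R) :
  (forall t : R, 0 <= t ->
    (opnorm (op S al al t) <= (M0 * expR (omega * t))%:E)%E) ->
  omega < a -> dist_reg al g <= 1 -> csmoothing S g al ->
  exists2 K : R, 0 < K & forall (t : R) (u : X g), 0 < t ->
    `|op S g al t u| <= K * t `^ (- dist_reg al g) * expR (a * t) * `|u|.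
Proof.
move=> hexp wa d1 [[d0 [M [_ hM]]] _]; set d := dist_reg al g in d0 d1 hM *.
have oM t : 0 < t -> t <= 1 -> forall u : X g,
    `|op S g al t u| <= `|M 1| * t `^ (- d) * `|u|.
  move=> t0 t1 u; have [|_] := hM 1 t; first by rewrite t0.
  move/(opnorm_leP u)/le_trans; apply.
  by rewrite ler_wpM2r// ler_wpM2r ?powR_ge0// ler_norm.
have M00 : 0 <= M0.
  have := le_trans (opnorm_ge0 _) (hexp _ (lexx 0)).
  by rewrite lee_fin mulr0 expR0 mulr1.
pose K1 := `|M 1| * expR `|a|.
pose K2 := M0 * expR (- omega) * `|M 1| / (a - omega).
have K10 : 0 <= K1 by rewrite mulr_ge0 ?expR_ge0.
have aw : 0 < a - omega by rewrite subr_gt0.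
have K20 : 0 <= K2 by rewrite divr_ge0 ?(ltW aw)// !mulr_ge0 ?expR_ge0.
(* The summand 1 only serves to make the constant positive. *)
exists (K1 + K2 + 1) => [|t u t0]; first lra.
have td0 : 0 <= t `^ (- d) by exact: powR_ge0.
have E0 := expR_ge0 (a * t).
have [t1|t1] := leP t 1.
  apply: le_trans (oM t t0 t1 u) _; rewrite ler_wpM2r//.
  apply: (@le_trans _ _ (K1 * t `^ (- d) * expR (a * t))); last first.
    by rewrite !ler_wpM2r//; lra.
  rewrite /K1 -!mulrA ler_wpM2l// mulrCA ler_peMr// -expRD.
  rewrite -[leLHS]expR0 ler_expR.
  have : - (a * t) <= `|a|.
    by rewrite (le_trans (ler_norm _))// normrN normrM (gtr0_norm t0) ler_piMr.
  lra.
have t10 : 0 <= t - 1 by rewrite subr_ge0 ltW.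
have m1 : maps_into S 1 g al by have [|] := hM 1 1; rewrite ?ltr01 ?lexx.
rewrite -{1}(subrK 1 t) op_comp//.
apply: le_trans (opnorm_leP _ (hexp _ t10)) _.
apply: (@le_trans _ _ (M0 * expR (omega * (t - 1)) * (`|M 1| * `|u|))).
  apply: ler_wpM2l; first by rewrite mulr_ge0 ?expR_ge0.
  by have := oM 1 ltr01 (lexx _) u; rewrite powR1 mulr1.
rewrite mulrA ler_wpM2r//.
apply: (@le_trans _ _ (K2 * t `^ (- d) * expR (a * t))); last first.
  by rewrite !ler_wpM2r//; lra.
rewrite mulrBr mulr1 addrC expRD.
have -> : M0 * (expR (- omega) * expR (omega * t)) * `|M 1| =
  M0 * expR (- omega) * `|M 1| * expR (omega * t) by ring.
rewrite /K2 -!mulrA; apply: ler_wpM2l => //; apply: ler_wpM2l; first exact: expR_ge0.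
apply: ler_wpM2l => //.
have -> : a * t = omega * t + (a - omega) * t by ring.
rewrite expRD [leRHS]mulrA [leRHS]mulrCA ler_peMr ?expR_ge0//.
have : t `^ d <= t by rewrite ler1_powR// ltW.
have : (a - omega) * t <= expR ((a - omega) * t).
  by have := expR_ge1Dx ((a - omega) * t); lra.
rewrite powRN -invfM ler_pdivlMl ?mulr1; last by rewrite mulr_gt0 ?powR_gt0.
by move=> h1 h2; apply: le_trans h1; rewrite ler_pM2l.
Qed.

End scale.

(** * A priori estimates for mild solutions *)

(** The supremum [N] of [f] satisfies [N <= A + N / 2].  Boundedness of [f], even
    without any control of the bound, is what allows absorption. *)
Lemma half_contraction_le {R : realType} {T : Type} (D : set T)
    (f : T -> R) (A : R) :
  (forall t, 0 <= f t) -> (exists C, forall t, D t -> f t <= C) ->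
  (forall N, 0 <= N -> (forall s, D s -> f s <= N) ->
     forall t, D t -> f t <= A + N / 2) ->
  forall t, D t -> f t <= 2 * A.
Proof.
move=> f0 [C fC] fA t Dt; set N := sup (f @` D).
have ubf : has_ubound (f @` D) by exists C => _ [s Ds <-]; exact: fC.
have fN s : D s -> f s <= N by move=> Ds; apply: ub_le_sup => //; exists s.
have N0 : 0 <= N by rewrite (le_trans (f0 t))// fN.
have : N <= A + N / 2.
  apply: ge_sup; first by exists (f t), t.
  by move=> _ [s Ds <-]; exact: fA.
by have := fN t Dt; lra.
Qed.

(** Raising the [i]-th summand to the power [1 - d i] gives back [p i / kap i]. *)
Lemma le_growth_rate {R : realType} n (d p kap : 'I_n -> R) i :
  (forall i, d i < 1) -> (forall i, 0 < kap i) -> (forall i, 0 <= p i) ->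
  p i <= kap i * (\sum_j ((kap j)^-1 * p j) `^ (1 - d j)^-1) `^ (1 - d i).
Proof.
move=> d1 kap0 p0; rewrite -ler_pdivrMl//.
have q0 : 0 <= (kap i)^-1 * p i by rewrite mulr_ge0 ?invr_ge0 ?(ltW (kap0 i)).
have di : 0 < 1 - d i by rewrite subr_gt0.
have -> : (kap i)^-1 * p i = (((kap i)^-1 * p i) `^ (1 - d i)^-1) `^ (1 - d i).
  by rewrite -powRrM mulVf ?gt_eqF// powRr1.
rewrite ge0_ler_powR ?(ltW di) ?nnegrE ?powR_ge0 ?sumr_ge0//.
  by move=> j _; exact: powR_ge0.
by rewrite (bigD1 i)//= lerDl sumr_ge0// => j _; exact: powR_ge0.
Qed.

Lemma sum_half_weights_le {R : realType} n (x : 'I_n -> R) :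
  (forall i, 0 < x i) ->
  \sum_i (2 * n.+1%:R * x i)^-1 * x i <= 1 / 2.
Proof.
move=> x0.
have -> : \sum_i (2 * n.+1%:R * x i)^-1 * x i = \sum_(i < n) (2 * n.+1%:R : R)^-1.
  by apply: eq_bigr => i _; rewrite invfM -mulrA mulVf ?mulr1// gt_eqF.
rewrite sumr_const card_ord -[leLHS]mulr_natl ler_pdivrMr ?mulr_gt0 ?ltr0n//.
by rewrite mulrA divfK ?pnatr_eq0// mul1r ler_nat.
Qed.

Section duhamel.
Context {R : realType} {X : banach_scale R} (S : scale_family X).
Local Notation mu := (@lebesgue_measure R).

(** In the exponent, [a (t - s) + (a + m) s = (a + m) t - m (t - s)], so the
    integrand is at most [K p e^((a + m) t)] times a combination of two convolution
    kernels, whose integrals carry the factor [m^(d - 1)]; the assumption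
    [p <= kap m^(1 - d)] turns [p m^(d - 1)] into [kap].  It also forces [p = 0]
    when [m = 0], the case where the kernel estimate is not available.  Bounds on
    [u] of the form [N + B s^-e] cover both the late and the early regime. *)
Lemma bochner_duhamel_le {al b : indices X} {P : {linear X al -> X b}}
    {K p a m kap e N B t : R} {u : R -> X al} {y : X al} (d := dist_reg al b) :
  0 <= d < 1 -> 0 <= e < 1 -> 0 <= K -> 0 <= p -> 0 <= m -> 0 <= kap ->
  0 <= N -> 0 <= B ->
  0 < t ->
  (forall s (v : X b), 0 < s ->
    `|op S b al s v| <= K * s `^ (- d) * expR (a * s) * `|v|) ->
  (forall v, `|P v| <= p * `|v|) ->
  p <= kap * m `^ (1 - d) ->
  (forall s, 0 < s < t -> `|u s| <= expR ((a + m) * s) * (N + B * s `^ (- e))) ->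
  is_bochner_integral `]0, t[ (fun s => op S b al (t - s) (P (u s))) y ->
  `|y| <= expR ((a + m) * t) *
    (kap * K * (kernel_cst d 0 * N + kernel_cst d e * B * t `^ (- e))).
Proof.
move=> d01 e01 K0 p0 m0 kap0 N0 B0 t0 hK hP hp hu hy.
have [/andP[d0 d1] /andP[e0 e1]] := (d01, e01).
have C0 x : 0 <= x < 1 -> 0 <= kernel_cst d x.
  by move=> /andP[_ x1]; exact: ltW (kernel_cst_gt0 d1 x1).
have bnd s : 0 < s < t -> `|op S b al (t - s) (P (u s))| <=
    K * p * expR ((a + m) * t) * ((t - s) `^ (- d) * expR (- (m * (t - s))) *
     (N + B * s `^ (- e))).
  move=> s0t; have /andP[s0 st] := s0t; have ts : 0 < t - s by rewrite subr_gt0.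
  apply: le_trans (hK _ _ ts) _.
  apply: (@le_trans _ _ (K * (t - s) `^ (- d) * expR (a * (t - s)) *
      (p * (expR ((a + m) * s) * (N + B * s `^ (- e)))))).
    apply: ler_wpM2l; first by rewrite !mulr_ge0 ?powR_ge0 ?expR_ge0.
    by apply: le_trans (hP _) _; rewrite ler_wpM2l// hu.
  have -> : expR ((a + m) * t) =
      expR (a * (t - s)) * expR ((a + m) * s) * expR (m * (t - s)).
    by rewrite -!expRD; congr expR; ring.
  set E1 := expR (a * _); set E2 := expR ((a + m) * s).
  have E3 := expRxMexpNx_1 (m * (t - s)).
  set E4 := expR (m * _) in E3 *; set E5 := expR (- _) in E3 *.
  set q := _ `^ (- d); set w := N + _.
  have -> : K * p * (E1 * E2 * E4) * (q * E5 * w) =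
     K * q * E1 * (p * (E2 * w)) * (E4 * E5) by ring.
  by rewrite E3 mulr1.
have [p00|p00] := eqVneq p 0.
  have : (`|y|%:E <= \int[mu]_(s in `]0%R, t[) (0:R)%:E)%E.
    apply: (bochner_norm_le (fun=> 0)) hy => //.
    move=> s; rewrite /= in_itv/= => s0t.
    by have := bnd s s0t; rewrite p00 mulr0 !mul0r.
  rewrite integral0 lee_fin => /le_trans; apply.
  rewrite mulr_ge0 ?expR_ge0//.
  by rewrite mulr_ge0 ?addr_ge0 ?mulr_ge0 ?powR_ge0 ?C0 ?lexx ?ltr01.
have pp : 0 < p by rewrite lt_neqAle eq_sym p00.
have mp : 0 < m.
  rewrite lt_neqAle m0 andbT; apply/eqP => m00.
  move: hp; rewrite -m00 powR0 ?mulr0; last by rewrite gt_eqF// subr_gt0.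
  by move=> /(lt_le_trans pp); rewrite ltxx.
set k0 := convolution_kernel d 0 m t; set ke := convolution_kernel d e m t.
set L := K * p * expR ((a + m) * t).
have L0 : 0 <= L by rewrite !mulr_ge0 ?expR_ge0.
have hyI :
    (`|y|%:E <= \int[mu]_(s in `]0%R, t[) (L * N * k0 s + L * B * ke s)%:E)%E.
  apply: (bochner_norm_le (fun s => L * N * k0 s + L * B * ke s)) hy => //.
    by apply: measurable_funD; apply: measurable_funM => //;
      exact: measurable_convolution_kernel.
  move=> s; rewrite /= in_itv/= => s0t; apply: le_trans (bnd s s0t) _.
  rewrite -/L /k0 /ke /convolution_kernel oppr0 powRr0 le_eqVlt; apply/orP; left.
  by apply/eqP; ring.
have LN : 0 <= L * N by rewrite mulr_ge0.
have LB : 0 <= L * B by rewrite mulr_ge0.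
have mk x : measurable_fun `]0%R, t[ (fun s => (convolution_kernel d x m t s)%:E).
  by apply/measurable_EFinP; exact: measurable_convolution_kernel.
have k00 x s : (0 <= (convolution_kernel d x m t s)%:E)%E.
  by rewrite lee_fin convolution_kernel_ge0.
have {hyI} : (`|y|%:E <= (L * N)%:E * \int[mu]_(s in `]0%R, t[) (k0 s)%:E +
    (L * B)%:E * \int[mu]_(s in `]0%R, t[) (ke s)%:E)%E.
  apply: le_trans hyI _.
  under eq_integral do rewrite EFinD EFinM (EFinM (L * B)).
  rewrite ge0_integralD//.
  - rewrite !ge0_integralZl_EFin//; by [exact: mk|move=> s _; exact: k00].
  - by move=> s _; apply: mule_ge0; rewrite ?k00 ?lee_fin.
  - apply/measurable_EFinP/measurable_funM => //.
    exact: measurable_convolution_kernel.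
  - by move=> s _; apply: mule_ge0; rewrite ?k00 ?lee_fin.
  - apply/measurable_EFinP/measurable_funM => //.
    exact: measurable_convolution_kernel.
have I0 : 0 <= (0:R) < 1 by rewrite lexx ltr01.
have := integral_convolution_kernel_le d 0 m t d01 I0 mp t0.
have := integral_convolution_kernel_le d e m t d01 e01 mp t0.
rewrite -/k0 -/ke oppr0 powRr0 mulr1 => hke hk0 hyI.
have : (`|y|%:E <= (L * N)%:E * (kernel_cst d 0 * m `^ (d - 1))%:E +
    (L * B)%:E * (kernel_cst d e * m `^ (d - 1) * t `^ (- e))%:E)%E.
  apply: le_trans hyI _; apply: leeD; apply: lee_wpmul2l => //; by rewrite lee_fin.
rewrite -!EFinM -EFinD lee_fin => /le_trans; apply.
have -> : L * N * (kernel_cst d 0 * m `^ (d - 1)) +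
    L * B * (kernel_cst d e * m `^ (d - 1) * t `^ (- e)) =
  expR ((a + m) * t) * ((p * m `^ (d - 1)) * K *
    (kernel_cst d 0 * N + kernel_cst d e * B * t `^ (- e))) by rewrite /L; ring.
rewrite ler_wpM2l ?expR_ge0// ler_wpM2r//.
  by rewrite addr_ge0// ?mulr_ge0 ?powR_ge0 ?C0.
rewrite ler_wpM2r//.
have m1 : m `^ (1 - d) * m `^ (d - 1) = 1.
  rewrite -powRD; last by rewrite (gt_eqF mp) implybT.
  by rewrite (_ : 1 - d + (d - 1) = 0) ?powRr0//; lra.
apply: le_trans (ler_wpM2r (powR_ge0 m (d - 1)) hp) _.
by rewrite -mulrA m1 mulr1.
Qed.

End duhamel.

Section mild_solution.
Context {R : realType} {X : banach_scale R} (S : scale_family X).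
Context {n : nat} {al : indices X} {b : 'I_n -> indices X}.
Context {P : forall i, {linear X al -> X (b i)}}.
Context {g : indices X} {u0 : X g} {u : R -> X al}.
Context {a A : R} {K p : 'I_n -> R}.
Let d i := dist_reg al (b i).
Let e := dist_reg al g.
Hypothesis d01 : forall i, 0 <= d i < 1.
Hypothesis e01 : 0 <= e < 1.
Hypothesis K_ge0 : forall i, 0 <= K i.
Hypothesis p_ge0 : forall i, 0 <= p i.
Hypothesis A_ge0 : 0 <= A.
Hypothesis smoothing_b : forall i s (v : X (b i)), 0 < s ->
  `|op S (b i) al s v| <= K i * s `^ (- d i) * expR (a * s) * `|v|.
Hypothesis norm_P : forall i v, `|P i v| <= p i * `|v|.
Hypothesis smoothing_u0 : forall s, 0 < s ->
  `|op S g al s u0| <= A * s `^ (- e) * expR (a * s).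
Hypothesis u_mild : is_mild_solution S P u0 u.

Lemma mild_norm_le m (kap : 'I_n -> R) N B t :
  0 <= m -> (forall i, 0 <= kap i) -> 0 <= N -> 0 <= B -> 0 < t ->
  (forall i, p i <= kap i * m `^ (1 - d i)) ->
  (forall s, 0 < s < t -> `|u s| <= expR ((a + m) * s) * (N + B * s `^ (- e))) ->
  `|u t| <= expR ((a + m) * t) * (A * t `^ (- e) +
    \sum_i kap i * K i *
      (kernel_cst (d i) 0 * N + kernel_cst (d i) e * B * t `^ (- e))).
Proof.
move=> m0 kap0 N0 B0 t0 hp hu; have [_ /(_ t t0)[I [hI ->]]] := u_mild.
rewrite mulrDr; apply: le_trans (ler_normD _ _) _; apply: lerD.
  apply: le_trans (smoothing_u0 _ t0) _.
  rewrite mulrC ler_wpM2r ?mulr_ge0 ?powR_ge0// ler_expR mulrDl lerDl.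
  by rewrite mulr_ge0// ltW.
rewrite mulr_sumr; apply: le_trans (ler_norm_sum _ _ _) _; apply: ler_sum => i _.
exact: (bochner_duhamel_le S (d01 i) e01 (K_ge0 i) (p_ge0 i) m0 (kap0 i) N0 B0 t0
  (smoothing_b i) (norm_P i) (hp i) hu (hI i)).
Qed.

Lemma mild_locally_bounded m T : 0 < T ->
  exists C, forall t, 0 < t <= T -> t `^ e * (expR (- (m * t)) * `|u t|) <= C.
Proof.
move=> T0; have [[_ /(_ T T0)[C hC]] _] := u_mild.
exists (expR (`|m| * T) * C) => t /[dup] t0T /andP[t0 tT].
rewrite mulrCA ler_pM ?expR_ge0 ?mulr_ge0 ?powR_ge0//; last exact: hC.
rewrite ler_expR -mulNr (le_trans (ler_norm _))// normrM normrN gtr0_norm//.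
by rewrite ler_wpM2l.
Qed.

(** Absorption with the weight [t^e e^(-(a + m) t)] on [(0, t]]. *)
Lemma mild_weighted_le m (kap : 'I_n -> R) t : 0 <= m -> (forall i, 0 <= kap i) ->
  (forall i, p i <= kap i * m `^ (1 - d i)) ->
  \sum_i kap i * K i * kernel_cst (d i) e <= 1 / 2 ->
  0 < t -> `|u t| <= 2 * A * t `^ (- e) * expR ((a + m) * t).
Proof.
move=> m0 kap0 hp hsum t0.
pose f s := s `^ e * (expR (- ((a + m) * s)) * `|u s|).
have fE s B : 0 < s ->
    (f s <= B) = (`|u s| <= expR ((a + m) * s) * (B * s `^ (- e))).
  move=> s0; rewrite /f powRN expRN mulrCA ler_pdivrMl ?expR_gt0//.
  by rewrite mulrA ler_pdivlMr ?powR_gt0// [`|u s| * _]mulrC.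
have : f t <= 2 * A.
  apply: (@half_contraction_le _ _ `]0, t]%classic f); rewrite /= ?in_itv/= ?t0//=.
  - by move=> s; rewrite /f !mulr_ge0 ?powR_ge0 ?expR_ge0.
  - have [C hC] := mild_locally_bounded (a + m) _ t0.
    by exists C => s; rewrite in_itv/=; exact: hC.
  move=> B B0 hB s; rewrite in_itv/= => /andP[s0 st].
  rewrite fE//.
  apply: le_trans (mild_norm_le m kap 0 B s m0 kap0 _ B0 s0 hp _) _ => //.
    move=> r /andP[r0 rs]; rewrite add0r -fE// hB// in_itv/= r0.
    by rewrite (le_trans (ltW rs)).
  rewrite ler_wpM2l ?expR_ge0// mulrDl lerD2l.
  under eq_bigr do rewrite mulr0 add0r mulrA (mulrA _ _ B) -mulrA.
  rewrite -mulr_suml mulrA ler_wpM2r ?powR_ge0// mulrC ler_wpM2l//; lra.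
by rewrite fE// mulrC.
Qed.

(** Absorption with the weight [e^(-(a + m) t)] on [(T, t]].  On [(0, T]] the
    weighted norm of [u] is at most [B s^-e], which is added to the supremum over
    [(T, t]] and contributes only to the constant.  Hence the weights [kap] have to
    be small relative to the kernel constants with exponent 0 alone. *)
Lemma mild_late_le m (kap : 'I_n -> R) T B t :
  0 <= m -> (forall i, 0 <= kap i) ->
  (forall i, p i <= kap i * m `^ (1 - d i)) ->
  \sum_i kap i * K i * kernel_cst (d i) 0 <= 1 / 2 ->
  0 < T -> 0 <= B ->
  (forall s, 0 < s <= T -> `|u s| <= expR ((a + m) * s) * (B * s `^ (- e))) ->
  T < t ->
  `|u t| <= 2 * ((A + (\sum_i kap i * K i * kernel_cst (d i) e) * B) *
    T `^ (- e)) * expR ((a + m) * t).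
Proof.
move=> m0 kap0 hp hsum T0 B0 early Tt.
have t0 := lt_trans T0 Tt; have [/andP[e0 e1]] := e01.
pose f s := expR (- ((a + m) * s)) * `|u s|.
have fE s N : (f s <= N) = (`|u s| <= expR ((a + m) * s) * N).
  by rewrite /f expRN ler_pdivrMl ?expR_gt0.
set A' := (A + _ * B) * _.
have : f t <= 2 * A'; last by rewrite fE mulrC.
apply: (@half_contraction_le _ _ `]T, t]%classic f); rewrite /= ?in_itv/= ?Tt ?lexx//=.
- by move=> s; rewrite /f !mulr_ge0 ?expR_ge0.
- have [C hC] := mild_locally_bounded (a + m) _ t0.
  exists (T `^ (- e) * C) => s; rewrite in_itv/= => /andP[Ts st].
  have s0 := lt_trans T0 Ts.
  rewrite powRN ler_pdivlMl ?powR_gt0//.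
  apply: le_trans (hC s _); last by rewrite s0.
  by rewrite ler_wpM2r ?mulr_ge0 ?expR_ge0// ge0_ler_powR ?nnegrE// ltW.
move=> N N0 hN s; rewrite in_itv/= => /andP[Ts st]; have s0 := lt_trans T0 Ts.
have sT : s `^ (- e) <= T `^ (- e).
  by rewrite !powRN lef_pV2 ?posrE ?powR_gt0// ge0_ler_powR ?nnegrE// ltW.
rewrite fE; apply: le_trans (mild_norm_le m kap N B s m0 kap0 N0 B0 s0 hp _) _.
  move=> r /andP[r0 rs]; have [rT|Tr] := leP r T.
    apply: le_trans (early r _) _; first by rewrite r0.
    by rewrite ler_wpM2l ?expR_ge0// lerDr.
  have : f r <= N by apply: hN; rewrite in_itv/= Tr (le_trans (ltW rs)).
  rewrite fE => /le_trans; apply; rewrite ler_wpM2l ?expR_ge0// lerDl.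
  by rewrite mulr_ge0 ?powR_ge0.
rewrite ler_wpM2l ?expR_ge0//.
under eq_bigr do rewrite mulrDr !mulrA.
rewrite big_split/= -!mulr_suml.
set sg := \sum_i _ * kernel_cst _ e.
have sg0 : 0 <= sg.
  apply: sumr_ge0 => i _; have /andP[_ d1] := d01 i.
  by rewrite !mulr_ge0// ltW// kernel_cst_gt0.
rewrite /A' mulrDl -/sg.
have h1 : A * s `^ (- e) <= A * T `^ (- e) by exact: ler_wpM2l.
have h2 : sg * B * s `^ (- e) <= sg * B * T `^ (- e).
  by rewrite ler_wpM2l// mulr_ge0.
have h3 : (\sum_i kap i * K i * kernel_cst (d i) 0) * N <= 1 / 2 * N.
  exact: ler_wpM2r.
lra.
Qed.

End mild_solution.

(** Without mild solution the value of [perturbed] is 0. *)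
Lemma perturbed_norm_le {R : realType} {X : banach_scale R} (S : scale_family X)
    {n} {al : indices X} {b : 'I_n -> indices X}
    (P : forall i, {linear X al -> X (b i)}) g (u0 : X g) (t C : R) : 0 < t -> 0 <= C ->
  (forall u, is_mild_solution S P u0 u -> `|u t| <= C) ->
  `|perturbed S P g t u0| <= C.
Proof.
move=> t0 C0 hC; rewrite /perturbed gt_eqF//.
by case: xgetP => [u _|_]; [exact: hC|rewrite normr0].
Qed.

Theorem proposition6p16 (R : realType) (X : banach_scale R) (S : scale_family X)
    (alpha : indices X) (n : nat) (M0 omega : R)
    (hS : semigroup_in_scale S)
    (hexp : forall t : R, 0 <= t ->
      (opnorm (op S alpha alpha t) <= (M0 * expR (omega * t))%:E)%E)
    (a : R) (ha : omega < a) :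
  exists (M1 : R) (c : indices X -> R),
    forall (beta : 'I_n -> indices X) (r : R), 0 < r ->
      (forall P : forall i, {linear X alpha -> X (beta i)},
         (forall i, perturbation_class S r (P i)) ->
         forall (u0 : X alpha) (t : R), 0 < t ->
           `|perturbed S P alpha t u0| <= M1 * `|u0| * expR ((a + theta P c) * t))
      /\
      (forall (gamma : indices X) (T : R), Eset S alpha gamma -> 0 < T ->
         exists M : R,
           forall P : forall i, {linear X alpha -> X (beta i)},
             (forall i, perturbation_class S r (P i)) ->
             forall t : R, 0 < t ->
               (opnorm (perturbed S P gamma t) <=
                 (if t <= T then M / t `^ dist_reg alpha gamma
                  else M * expR ((a + theta P c) * t))%:E)%E).
Proof.
have : forall g, exists k : R, 0 < k /\
    (csmoothing S g alpha -> dist_reg alpha g < 1 -> forall s (v : X g), 0 < s ->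
    `|op S g alpha s v| <= k * s `^ (- dist_reg alpha g) * expR (a * s) * `|v|).
  move=> g.
  have [[sg d1]|nsg] :=
    pselect (csmoothing S g alpha /\ dist_reg alpha g < 1).
    have [k k0 hk] :=
      smoothing_expR_bound S hS alpha g M0 omega a hexp ha (ltW d1) sg.
    by exists k; split => // _ _ s v; exact: hk.
  by exists 1; split => // sg d1; case: nsg.
move=> /choice[K hK].
have K_gt0 g : 0 < K g by have [] := hK g.
have M00 : 0 <= M0.
  have := le_trans (opnorm_ge0 _) (hexp _ (lexx 0)).
  by rewrite lee_fin mulr0 expR0 mulr1.
(* These weights give each of the at most n terms the factor 1 / (2 (n + 1)). *)
pose kap (e : R) g := (2 * n.+1%:R * (K g * kernel_cst (dist_reg alpha g) e))^-1.
pose c g := (kap 0 g)^-1 `^ (1 - dist_reg alpha g)^-1.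
exists (2 * M0), c => beta r r0.
pose d i := dist_reg alpha (beta i).
have kap_gt0 e i : d i < 1 -> e < 1 -> 0 < kap e (beta i).
  move=> d1 e1; rewrite invr_gt0 mulr_gt0 ?mulr_gt0 ?ltr0n//.
  exact: kernel_cst_gt0 d1 e1.
have kap_sum e : (forall i, d i < 1) -> e < 1 ->
    \sum_i kap e (beta i) * K (beta i) * kernel_cst (d i) e <= 1 / 2.
  move=> d1 e1; under eq_bigr do rewrite -mulrA.
  apply: sum_half_weights_le => i; rewrite mulr_gt0//; exact: kernel_cst_gt0 (d1 i) e1.
have class (P : forall i, {linear X alpha -> X (beta i)}) :
    (forall i, perturbation_class S r (P i)) ->
  [/\ forall i, 0 <= d i < 1,
      forall i s (v : X (beta i)), 0 < s -> `|op S (beta i) alpha s v| <=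
        K (beta i) * s `^ (- d i) * expR (a * s) * `|v|,
      forall i v, `|P i v| <= fine (opnorm (P i)) * `|v|,
      forall i, 0 <= fine (opnorm (P i)) <= r &
      (forall i, fine (opnorm (P i)) <= kap 0 (beta i) * theta P c `^ (1 - d i)) /\
        0 <= theta P c].
  move=> hP.
  have d01 i : 0 <= d i < 1 by have [di _ _] := hP i.
  have d1 i : d i < 1 by have /andP[] := d01 i.
  have fP i : (fine (opnorm (P i)))%:E = opnorm (P i).
    rewrite fineK// ge0_fin_numE ?opnorm_ge0//.
    by have [_ _ /le_lt_trans] := hP i; apply; exact: ltry.
  have p0 i : 0 <= fine (opnorm (P i)) by apply: fine_ge0; exact: opnorm_ge0.
  have thetaE : theta P c =
      \sum_j ((kap 0 (beta j))^-1 * fine (opnorm (P j))) `^ (1 - d j)^-1.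
    apply: eq_bigr => j _; rewrite powRM// invr_ge0 ltW//; exact: kap_gt0.
  split => //.
  - by move=> i; have [_ /(_ _ (d1 i))] := hK (beta i); apply; have [_ bi _] := hP i.
  - by move=> i v; apply: opnorm_leP; rewrite fP.
  - by move=> i; rewrite p0 -lee_fin fP; have [_ _ Pi] := hP i.
  split.
    move=> i; rewrite thetaE.
    apply: (le_growth_rate n d (fun i => fine (opnorm (P i)))
      (fun i => kap 0 (beta i))) => // j.
    exact: kap_gt0.
  by rewrite thetaE sumr_ge0// => j _; exact: powR_ge0.
split.
  move=> P /class[d01 hb hPn hp [hth th0]] u0 t t0.
  apply: perturbed_norm_le => //; first by rewrite !mulr_ge0 ?expR_ge0.
  move=> u hu.
  have e0 : dist_reg alpha alpha = 0 by rewrite /dist_reg subrr.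
  have e01 : 0 <= dist_reg alpha alpha < 1 by rewrite e0 lexx ltr01.
  have d1 i : d i < 1 by have /andP[] := d01 i.
  have hp0 i : 0 <= fine (opnorm (P i)) by have /andP[] := hp i.
  have hu0 s : 0 < s -> `|op S alpha alpha s u0| <=
      M0 * `|u0| * s `^ (- dist_reg alpha alpha) * expR (a * s).
    move=> s0; apply: le_trans (opnorm_leP u0 (hexp _ (ltW s0))) _.
    rewrite e0 oppr0 powRr0 mulr1 mulrAC ler_wpM2l ?mulr_ge0// ler_expR.
    by rewrite ler_wpM2r// ltW.
  have := mild_weighted_le S d01 e01 (fun i => ltW (K_gt0 (beta i))) hp0
    (mulr_ge0 M00 (normr_ge0 u0)) hb hPn hu0 hu (theta P c)
    (fun i => kap 0 (beta i)) t th0 (fun i => ltW (kap_gt0 0 i (d1 i) ltr01)) hth.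
  by rewrite e0 oppr0 powRr0 mulr1 mulrA; apply => //; exact: kap_sum.
move=> gamma T [/andP[gl gu] sg] T0.
set e := dist_reg alpha gamma.
have e01 : 0 <= e < 1 by rewrite /e /dist_reg; apply/andP; split; lra.
have e1 : e < 1 by have /andP[] := e01.
(* L is the growth rate for perturbations of norm r, with weights adapted to e. *)
pose L := \sum_j ((kap e (beta j))^-1 * r) `^ (1 - d j)^-1.
have L0 : 0 <= L by rewrite sumr_ge0// => j _; exact: powR_ge0.
pose sig := \sum_i kap 0 (beta i) * K (beta i) * kernel_cst (d i) e.
(* Q1 serves the times up to T, Q2 the later ones. *)
pose Q1 := 2 * K gamma * expR ((`|a| + L) * T).
pose Q2 := 2 * ((K gamma + sig * (2 * K gamma * expR (L * T))) * T `^ (- e)).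
exists (Q1 + Q2) => P hP t t0; have [d01 hb hPn hp [hth th0]] := class P hP.
have d1 i : d i < 1 by have /andP[] := d01 i.
have hp0 i : 0 <= fine (opnorm (P i)) by have /andP[] := hp i.
have sig0 : 0 <= sig.
  apply: sumr_ge0 => i _; rewrite !mulr_ge0 ?(ltW (K_gt0 _)) ?ltW//.
  - exact: kap_gt0.
  - exact: kernel_cst_gt0.
have Kg := ltW (K_gt0 gamma).
have Q10 : 0 <= Q1 by rewrite !mulr_ge0 ?expR_ge0.
have Q20 : 0 <= Q2 by rewrite !mulr_ge0 ?addr_ge0 ?mulr_ge0 ?powR_ge0 ?expR_ge0.
have hL i : fine (opnorm (P i)) <= kap e (beta i) * L `^ (1 - d i).
  have /andP[_ /le_trans] := hp i; apply.
  apply: (le_growth_rate n d (fun=> r) (fun i => kap e (beta i))) => //.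
    by move=> j; exact: kap_gt0.
  by move=> _; exact: ltW.
have hu0 (u0 : X gamma) s : 0 < s -> `|op S gamma alpha s u0| <=
    K gamma * `|u0| * s `^ (- e) * expR (a * s).
  move=> s0; have [_ /(_ sg e1 s u0 s0)] := hK gamma.
  by move/le_trans; apply; rewrite le_eqVlt; apply/orP; left; apply/eqP; ring.
have short (u0 : X gamma) u s : is_mild_solution S P u0 u -> 0 < s ->
    `|u s| <= 2 * (K gamma * `|u0|) * s `^ (- e) * expR ((a + L) * s).
  move=> hu s0.
  exact: (mild_weighted_le S d01 e01 (fun i => ltW (K_gt0 (beta i))) hp0
    (mulr_ge0 Kg (normr_ge0 u0)) hb hPn (hu0 u0) hu L
    (fun i => kap e (beta i)) s L0 (fun i => ltW (kap_gt0 e i (d1 i) e1)) hL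
    (kap_sum e d1 e1) s0).
have [tT|Tt] := leP t T; apply: opnorm_le.
- by rewrite mulr_ge0 ?addr_ge0// invr_ge0 powR_ge0.
- move=> u0; apply: perturbed_norm_le => //.
    by rewrite mulr_ge0// mulr_ge0 ?addr_ge0// invr_ge0 powR_ge0.
  move=> u hu; apply: le_trans (short u0 u t hu t0) _.
  apply: (@le_trans _ _ (Q1 / t `^ e * `|u0|)); last first.
    by rewrite ler_wpM2r// ler_wpM2r ?invr_ge0 ?powR_ge0// lerDl.
  have hE : expR ((a + L) * t) <= expR ((`|a| + L) * T).
    rewrite ler_expR (@le_trans _ _ ((`|a| + L) * t))//.
      by rewrite ler_wpM2r ?(ltW t0)// lerD2r ler_norm.
    by rewrite ler_wpM2l// addr_ge0.
  have -> : Q1 / t `^ e * `|u0| =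
      2 * (K gamma * `|u0|) * t `^ (- e) * expR ((`|a| + L) * T).
    by rewrite /Q1 powRN; ring.
  by rewrite ler_wpM2l// !mulr_ge0 ?powR_ge0.
- by rewrite mulr_ge0 ?addr_ge0 ?expR_ge0.
move=> u0; apply: perturbed_norm_le => //.
  by rewrite mulr_ge0// mulr_ge0 ?addr_ge0 ?expR_ge0.
move=> u hu.
pose B := 2 * (K gamma * `|u0|) * expR (L * T).
have B0 : 0 <= B by rewrite !mulr_ge0 ?expR_ge0.
have early s : 0 < s <= T ->
    `|u s| <= expR ((a + theta P c) * s) * (B * s `^ (- e)).
  move=> /andP[s0 sT]; apply: le_trans (short u0 u s hu s0) _.
  have hE : expR ((a + L) * s) <= expR ((a + theta P c) * s) * expR (L * T).
    rewrite -expRD ler_expR.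
    have : L * s <= L * T by rewrite ler_wpM2l.
    have : 0 <= theta P c * s by rewrite mulr_ge0// ltW.
    by rewrite !mulrDl; lra.
  have -> : expR ((a + theta P c) * s) * (B * s `^ (- e)) =
      2 * (K gamma * `|u0|) * s `^ (- e) *
        (expR ((a + theta P c) * s) * expR (L * T)) by rewrite /B; ring.
  by rewrite ler_wpM2l// !mulr_ge0 ?powR_ge0.
have := mild_late_le S d01 e01 (fun i => ltW (K_gt0 (beta i))) hp0
  (mulr_ge0 Kg (normr_ge0 u0)) hb hPn (hu0 u0) hu (theta P c)
  (fun i => kap 0 (beta i)) T B t th0 (fun i => ltW (kap_gt0 0 i (d1 i) ltr01)) hth
  (kap_sum 0 d1 ltr01) T0 B0 early Tt.
move/le_trans; apply.
apply: (@le_trans _ _ (Q2 * expR ((a + theta P c) * t) * `|u0|)).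
  rewrite le_eqVlt; apply/orP; left; apply/eqP.
  by rewrite /Q2 /B -/e -/sig; ring.
by rewrite ler_wpM2r// ler_wpM2r ?expR_ge0// lerDr.
Qed.
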